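(* Let the standing setting and assumptions given in the context hold, let $\{\alpha_k\}_{k\ge 0}$ be nonnegative with $\sum_{k=0}^\infty\sqrt{\alpha_k}<\infty$, and let $\{\lambda_k\}_{k\ge0}$ and $\{x_k\}_{k\ge0}$ be generated by the misspecified inexact augmented Lagrangian scheme (defined in the context) with constant penalty $\rho>0$ and $\lambda_0=\mathbf 0$. Let $\bar x_k:=\frac1{k+1}\sum_{i=0}^kx_i$, and let $\lambda^*\in\operatorname{argmax}_\lambda g_0(\lambda;\theta^* )$. Then for all $k\ge0$, $$d_{\mathbb R^m_-}\big(h(\bar x_k;\theta^* )\big)\le\mathcal V(k):=\frac{C_1}{\sqrt{k+1}}+\frac{C_2}{k+1},$$ where $$C_1:=\sqrt{\frac{2B_g}{\rho}+\left(\frac{C_\lambda}{\rho}\right)^2},\qquad C_2:=\sqrt{\tfrac2\rho}\sum_{i=0}^\infty\sqrt{\alpha_i}+\frac{(L_h+M_h)\|\theta_0-\theta^*\|}{1-q_\ell},$$ $$C_\lambda:=\sqrt{2\rho}\sum_{i=0}^\infty\sqrt{\alpha_i}+\rho M_h\frac{\|\theta_0-\theta^*\|}{1-q_\ell}+\|\lambda^*\|,\qquad B_g:=\frac{1}{2\rho}\|\lambda^*\|^2+C_\lambda\left(\sqrt{\tfrac{2}{\rho}}\sum_{k=0}^\infty\sqrt{\alpha_k}+\frac{M_h\|\theta_0-\theta^*\|}{1-q_\ell}\right).$$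
   Context: Notation: $\|\cdot\|$ is the Euclidean norm; $B(0,1)$ is the closed unit ball; for a closed convex set $S$, $d_S(x)=\min_{s\in S}\|x-s\|$ and $d_S^2(x)=(d_S(x))^2$; $\mathbb R^m_+$, $\mathbb R^m_-$ are the nonnegative and nonpositive orthants. Problem. $X\subseteq\mathbb R^n$ and $\Theta\subseteq\mathbb R^d$ are convex compact sets, $f:\mathbb R^n\times\Theta\to\mathbb R\cup\{+\infty\}$, $h:\mathbb R^n\times\Theta\to\mathbb R^m$. For $\theta\in\Theta$, $\mathcal C(\theta)$ is the problem $\min\{f(x;\theta): h(x;\theta)\le 0,\ x\in X\}$. The true parameter $\theta^*\in\Theta$ is the unique minimizer over $\Theta$ of a learning objective $\ell$. $\mathcal C(\theta^* )$ has a finite optimal value $f^*$, its Lagrangian dual has a solution, and there is no duality gap. For $\rho>0$, $x\in X$, $\lambda\in\mathbb R^m$, $\theta\in\Theta$, the augmented Lagrangian is $$\mathcal L_\rho(x,\lambda;\theta)=f(x;\theta)+\tfrac{\rho}{2}d^2_{\mathbb R^m_-}\left(\tfrac{\lambda}{\rho}+h(x;\theta)\right)-\tfrac{\|\lambda\|^2}{2\rho}.$$ For $\rho=0$, $\mathcal L_0(x,\lambda;\theta)=f(x;\theta)+\lambda^\top h(x;\theta)$ if $\lambda\in\mathbb R^m_+$ and $-\infty$ otherwise. For $\rho\ge0$, $g_\rho(\lambda;\theta)=\inf_{x\in X}\mathcal L_\rho(x,\lambda;\theta)$; the Lagrangian dual of $\mathcal C(\theta)$ is $\max_\lambda g_0(\lambda;\theta)$.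 Standing assumptions: (i) $f(x;\theta)$ and each $h_j(x;\theta)$, $j=1,\dots,m$, are convex in $x\in X$ for all $\theta\in\Theta$. (ii) $|f(x;\theta_1)-f(x;\theta_2)|\le L_f\|\theta_1-\theta_2\|$ for all $x\in X$, $\theta_1,\theta_2\in\Theta$. (iii) $h(x;\theta)=A(\theta)x+b(\theta)$ with $A(\theta)\in\mathbb R^{m\times n}$, $b(\theta)\in\mathbb R^m$ Lipschitz continuous in $\theta$; $L_h$ is a constant with $\|h(x;\theta_1)-h(x;\theta_2)\|\le L_h\|\theta_1-\theta_2\|$ for all $x\in X$, $\theta_1,\theta_2\in\Theta$, and $\sigma_h$ is a constant with $h(B(0,1);\theta)\subseteq\sigma_hB(0,1)$ for all $\theta\in\Theta$. (iv) With $X^*(\lambda;\theta)=\operatorname{argmin}_{x\in X}\mathcal L_0(x,\lambda;\theta)$, there is $\kappa_X$ such that $X^*(\lambda;\theta_1)\subseteq X^*(\lambda;\theta_2)+\kappa_X\|\theta_1-\theta_2\|B(0,1)$ for all $\lambda\ge0$ and $\theta_1,\theta_2\in\Theta$. (v) $\{\theta_k\}_{k\ge0}\subset\Theta$ is a sequence with $\|\theta_k-\theta^*\|\le q_\ell^k\|\theta_0-\theta^*\|$ for all $k\ge0$, where $q_\ell\in(0,1)$. Constant $M_h$: $M_h\ge 0$ denotes a Lipschitz constant of $\nabla_\lambda g_\rho(\lambda;\cdot)$ on $\Theta$, uniform in $\lambda$, i.e. $\|\nabla_\lambda g_\rho(\lambda;\theta_1)-\nabla_\lambda g_\rho(\lambda;\theta_2)\|\le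 M_h\|\theta_1-\theta_2\|$ for all $\lambda\in\mathbb R^m$, $\theta_1,\theta_2\in\Theta$ (for $\rho>0$, $g_\rho(\cdot;\theta)$ is everywhere finite, concave and continuously differentiable). Misspecified inexact augmented Lagrangian scheme: given $\rho>0$, $\lambda_0=\mathbf 0\in\mathbb R^m$, and sequences $\{\alpha_k\}$, $\{\theta_k\}$, for each $k\ge0$: (1) choose any $x_k\in X$ with $\mathcal L_\rho(x_k,\lambda_k;\theta_k)\le g_\rho(\lambda_k;\theta_k)+\alpha_k$; (2) set $\lambda_{k+1}=\lambda_k+\rho\nabla_\lambda\mathcal L_\rho(x_k,\lambda_k;\theta_k)$. *)

(* Defs.v *)
From HB Require Import structures.
From mathcomp Require Import all_boot all_order all_algebra.
From mathcomp Require Import all_classical all_reals all_analysis.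
Set Implicit Arguments.
Unset Strict Implicit.
Unset Printing Implicit Defensive.
Import Order.TTheory GRing.Theory Num.Theory.
Import numFieldNormedType.Exports.
Local Open Scope classical_set_scope.
Local Open Scope ring_scope.

(* The library norm `|x| on matrices is the sup norm.  On column vectors enorm
   is the Euclidean norm; on general matrices it is the Frobenius norm. *)
Definition enorm (R : realType) (p q : nat) (M : 'M[R]_(p, q)) : R :=
  Num.sqrt (\sum_i \sum_j M i j ^+ 2).

Definition unit_ball (R : realType) (p : nat) : set 'cV[R]_p :=
  [set x | enorm x <= 1].

Definition nonneg_orthant (R : realType) (p : nat) : set 'cV[R]_p :=
  [set x | forall i, 0 <= x i 0].

Definition nonpos_orthant (R : realType) (p : nat) : set 'cV[R]_p :=
  [set x | forall i, x i 0 <= 0].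

(* For S nonempty and closed the infimum is attained. *)
Definition dist (R : realType) (p : nat) (S : set 'cV[R]_p) (x : 'cV[R]_p) : R :=
  inf [set enorm (x - s) | s in S].

Definition argmin {T : Type} {disp : Order.disp_t} {Y : porderType disp}
    (S : set T) (F : T -> Y) : set T :=
  [set x | S x /\ forall y, S y -> (F x <= F y)%O].

Definition argmax {T : Type} {disp : Order.disp_t} {Y : porderType disp}
    (S : set T) (F : T -> Y) : set T :=
  [set x | S x /\ forall y, S y -> (F y <= F x)%O].

(* Convexity on D of a function with values in R \cup {+oo}; the library's
   convex_function is restricted to real-valued functions.  Since 0 * +oo = 0
   in \bar R, the cases t = 0 and t = 1 are trivially true. *)
Definition econvex_function (R : realType) (p : nat)
    (D : set 'cV[R]_p) (F : 'cV[R]_p -> \bar R) : Prop :=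
  forall (t : R) (x y : 'cV[R]_p), 0 <= t <= 1 -> D x -> D y ->
    (F (t *: x + (1 - t) *: y)%R <= t%:E * F x + (1 - t)%:E * F y)%E.

Definition gradient (R : realType) (p : nat) (phi : 'cV[R]_p -> R)
    (u : 'cV[R]_p) : 'cV[R]_p :=
  \col_j 'D_(delta_mx j 0) phi u.

(* For rho > 0 this is the augmented Lagrangian, for rho = 0 the ordinary
   Lagrangian, with value -oo when lam is not nonnegative. *)
Definition lagrangian (R : realType) (n d m : nat)
    (f : 'cV[R]_n -> 'cV[R]_d -> \bar R) (h : 'cV[R]_n -> 'cV[R]_d -> 'cV[R]_m)
    (rho : R) (x : 'cV[R]_n) (lam : 'cV[R]_m) (theta : 'cV[R]_d) : \bar R :=
  if rho == 0 then
    if lam \in @nonneg_orthant R m then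
      (f x theta + ((lam^T *m h x theta) 0 0)%:E)%E
    else -oo%E
  else
    (f x theta
     + (rho / 2 * dist (@nonpos_orthant R m) (rho^-1 *: lam + h x theta) ^+ 2)%:E
     - (enorm lam ^+ 2 / (2 * rho))%:E)%E.

Definition dual_function (R : realType) (n d m : nat) (X : set 'cV[R]_n)
    (f : 'cV[R]_n -> 'cV[R]_d -> \bar R) (h : 'cV[R]_n -> 'cV[R]_d -> 'cV[R]_m)
    (rho : R) (lam : 'cV[R]_m) (theta : 'cV[R]_d) : \bar R :=
  ereal_inf [set lagrangian f h rho x lam theta | x in X].

(* The gradients in lam of the Lagrangian and of the dual function, which are
   extended-valued, are taken through fine, at points where they are finite
   in a neighbourhood. *)
Definition grad_lagrangian (R : realType) (n d m : nat)
    (f : 'cV[R]_n -> 'cV[R]_d -> \bar R) (h : 'cV[R]_n -> 'cV[R]_d -> 'cV[R]_m)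
    (rho : R) (x : 'cV[R]_n) (lam : 'cV[R]_m) (theta : 'cV[R]_d) : 'cV[R]_m :=
  gradient (fun l => fine (lagrangian f h rho x l theta)) lam.

Definition grad_dual (R : realType) (n d m : nat) (X : set 'cV[R]_n)
    (f : 'cV[R]_n -> 'cV[R]_d -> \bar R) (h : 'cV[R]_n -> 'cV[R]_d -> 'cV[R]_m)
    (rho : R) (lam : 'cV[R]_m) (theta : 'cV[R]_d) : 'cV[R]_m :=
  gradient (fun l => fine (dual_function X f h rho l theta)) lam.

Definition lagrangian_argmin (R : realType) (n d m : nat) (X : set 'cV[R]_n)
    (f : 'cV[R]_n -> 'cV[R]_d -> \bar R) (h : 'cV[R]_n -> 'cV[R]_d -> 'cV[R]_m)
    (lam : 'cV[R]_m) (theta : 'cV[R]_d) : set 'cV[R]_n :=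
  argmin X (fun x => lagrangian f h 0 x lam theta).

Definition optimal_value (R : realType) (n d m : nat) (X : set 'cV[R]_n)
    (f : 'cV[R]_n -> 'cV[R]_d -> \bar R) (h : 'cV[R]_n -> 'cV[R]_d -> 'cV[R]_m)
    (theta : 'cV[R]_d) : \bar R :=
  ereal_inf [set f x theta | x in X `&` [set x | nonpos_orthant (h x theta)]].

(* Main.v *)
Require Import Defs.
From HB Require Import structures.
From mathcomp Require Import all_boot all_order all_algebra.
From mathcomp Require Import all_classical all_reals all_analysis.
From mathcomp Require Import ring lra.
Set Implicit Arguments.
Unset Strict Implicit.
Unset Printing Implicit Defensive.
Import Order.TTheory GRing.Theory Num.Theory.
Import numFieldNormedType.Exports.
Local Open Scope classical_set_scope.
Local Open Scope ring_scope.

(* The augmented Lagrangian is the minimum over w >= h(x; theta) of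
   f(x; theta) + lambda^T w + (rho/2) |w|^2, so g_rho(.; theta) is the infimum
   of a function that is strongly convex in w over the epigraph of the
   perturbation function.  Minimizing sequences have a common limit
   w(lambda; theta) in the w-component, it is the gradient of g_rho, and an
   alpha-optimal point has its w within sqrt(2 alpha / rho) of it.  Monotonicity
   makes lambda |-> lambda + rho w(lambda; theta_star) nonexpansive, and
   w(lambda_star; theta_star) = 0; hence |lambda_k - lambda_star| <= C_lambda.
   Since h(x_i; theta_i) <= (lambda_(i+1) - lambda_i) / rho, summation bounds the
   distance of h(xbar_k; theta_star) to the nonpositive orthant by
   (|lambda_(k+1)| / rho + L_h e0 / (1 - q_ell)) / (k + 1).  The stated rate then
   follows from rho C_1 >= sqrt 2 |lambda_star|; for k = 0 the bound
   |lambda_1| <= C_lambda + |lambda_star| has to be sharpened to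
   |lambda_1| <= C_lambda, using rho |w(0; theta_star)| <= |lambda_star|. *)

(** * The Euclidean inner product and norm *)

Definition dot (R : realType) (p : nat) (u v : 'cV[R]_p) : R :=
  \sum_i u i 0 * v i 0.

Lemma dotC (R : realType) (p : nat) (u v : 'cV[R]_p) : dot u v = dot v u.
Proof. by apply: eq_bigr => i _; rewrite mulrC. Qed.

Lemma dotDl (R : realType) (p : nat) (u v w : 'cV[R]_p) :
  dot (u + v) w = dot u w + dot v w.
Proof. by rewrite -big_split; apply: eq_bigr => i _; rewrite mxE mulrDl. Qed.

Lemma dotNl (R : realType) (p : nat) (u v : 'cV[R]_p) :
  dot (- u) v = - dot u v.
Proof. by rewrite -sumrN; apply: eq_bigr => i _; rewrite mxE mulNr. Qed.

Lemma dotZl (R : realType) (p : nat) (a : R) (u v : 'cV[R]_p) :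
  dot (a *: u) v = a * dot u v.
Proof. by rewrite mulr_sumr; apply: eq_bigr => i _; rewrite mxE mulrA. Qed.

Lemma dotDr (R : realType) (p : nat) (u v w : 'cV[R]_p) :
  dot u (v + w) = dot u v + dot u w.
Proof. by rewrite dotC dotDl !(dotC _ u). Qed.

Lemma dotNr (R : realType) (p : nat) (u v : 'cV[R]_p) :
  dot u (- v) = - dot u v.
Proof. by rewrite dotC dotNl dotC. Qed.

Lemma dotZr (R : realType) (p : nat) (a : R) (u v : 'cV[R]_p) :
  dot u (a *: v) = a * dot u v.
Proof. by rewrite dotC dotZl dotC. Qed.

Lemma dot0l (R : realType) (p : nat) (u : 'cV[R]_p) : dot 0 u = 0.
Proof. by rewrite -(scale0r u) dotZl mul0r. Qed.

Lemma dot0r (R : realType) (p : nat) (u : 'cV[R]_p) : dot u 0 = 0.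
Proof. by rewrite dotC dot0l. Qed.

Definition dotE := (dotDl, dotDr, dotNl, dotNr, dotZl, dotZr, dot0l, dot0r).

Lemma dot_ge0 (R : realType) (p : nat) (u : 'cV[R]_p) : 0 <= dot u u.
Proof. by apply: sumr_ge0 => i _; rewrite -expr2 sqr_ge0. Qed.

Lemma dot_delta (R : realType) (p : nat) (u : 'cV[R]_p) (j : 'I_p) :
  dot (delta_mx j 0) u = u j 0.
Proof.
rewrite /dot (bigD1 j) //= big1 => [|i /negPf ij].
  by rewrite mxE !eqxx mul1r addr0.
by rewrite mxE ij mul0r.
Qed.

Lemma enormE (R : realType) (p : nat) (u : 'cV[R]_p) :
  enorm u = Num.sqrt (dot u u).
Proof.
by congr Num.sqrt; apply: eq_bigr => i _; rewrite big_ord1 expr2.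
Qed.

Lemma enorm_ge0 (R : realType) (p : nat) (u : 'cV[R]_p) : 0 <= enorm u.
Proof. exact: sqrtr_ge0. Qed.

Lemma enorm_sqr (R : realType) (p : nat) (u : 'cV[R]_p) :
  enorm u ^+ 2 = dot u u.
Proof. by rewrite enormE sqr_sqrtr // dot_ge0. Qed.

Lemma enorm0 (R : realType) (p : nat) : enorm (0 : 'cV[R]_p) = 0.
Proof. by rewrite enormE dot0l sqrtr0. Qed.

Lemma enormN (R : realType) (p : nat) (u : 'cV[R]_p) : enorm (- u) = enorm u.
Proof. by rewrite !enormE !dotE opprK. Qed.

Lemma enormZ (R : realType) (p : nat) (a : R) (u : 'cV[R]_p) :
  0 <= a -> enorm (a *: u) = a * enorm u.
Proof.
move=> a0; rewrite !enormE !dotE mulrA sqrtrM ?mulr_ge0 // -expr2.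
by rewrite sqrtr_sqr ger0_norm.
Qed.

Lemma enorm_eq0 (R : realType) (p : nat) (u : 'cV[R]_p) :
  enorm u = 0 -> u = 0.
Proof.
move=> u0; have := enorm_sqr u; rewrite u0 expr0n /= => /esym/eqP.
rewrite psumr_eq0 => [/allP uE|i _]; last by rewrite -expr2 sqr_ge0.
apply/matrixP => i j; rewrite ord1 mxE; apply/eqP.
by have := uE i (mem_index_enum i); rewrite mulf_eq0 orbb.
Qed.

(** Cauchy-Schwarz: expand the square of [enorm v *: u - enorm u *: v] and divide by the product of
    the norms, which is why zero norms are split off. *)
Lemma dot_le_enorm (R : realType) (p : nat) (u v : 'cV[R]_p) :
  dot u v <= enorm u * enorm v.
Proof.
have [u0|u0] := eqVneq (enorm u) 0.
  by rewrite u0 (enorm_eq0 u0) dot0l mul0r.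
have [v0|v0] := eqVneq (enorm v) 0.
  by rewrite v0 (enorm_eq0 v0) dot0r mulr0.
have ab0 : 0 < enorm u * enorm v.
  by rewrite mulr_gt0 // lt_def ?u0 ?v0 enorm_ge0.
rewrite -(ler_pM2l ab0); have := dot_ge0 (enorm v *: u - enorm u *: v).
rewrite !dotE (dotC v u).
rewrite -(enorm_sqr u) -(enorm_sqr v).
by move: (enorm u) (enorm v) (dot u v) => a b c; lra.
Qed.

Lemma enormD (R : realType) (p : nat) (u v : 'cV[R]_p) :
  enorm (u + v) <= enorm u + enorm v.
Proof.
rewrite -ler_sqr ?nnegrE ?addr_ge0 ?enorm_ge0 //.
rewrite enorm_sqr !dotE (dotC v u) -!enorm_sqr.
by have := dot_le_enorm u v; lra.
Qed.

Lemma enorm_sum (R : realType) (p k : nat) (u : nat -> 'cV[R]_p) :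
  enorm (\sum_(i < k) u i) <= \sum_(i < k) enorm (u i).
Proof.
elim: k => [|k IH]; first by rewrite !big_ord0 enorm0.
by rewrite !big_ord_recr /= (le_trans (enormD _ _)) // lerD2r.
Qed.

(** * Distance to a set and to the nonpositive orthant *)

Lemma dist_le (R : realType) (p : nat) (S : set 'cV[R]_p) (y s : 'cV[R]_p) :
  S s -> dist S y <= enorm (y - s).
Proof.
move=> Ss; apply: ge_inf; last by exists s.
by exists 0 => _ [t _ <-]; exact: enorm_ge0.
Qed.

Lemma dist_nonpos_sqr (R : realType) (p : nat) (y : 'cV[R]_p) :
  dist (@nonpos_orthant R p) y ^+ 2 = \sum_i Num.max 0 (y i 0) ^+ 2.
Proof.
(* The nearest point of the orthant truncates the positive coordinates to zero. *)
pose t := \col_i Num.min 0 (y i 0).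
have tS : nonpos_orthant t by move=> i; rewrite mxE ge_min lexx.
have -> : dist (@nonpos_orthant R p) y = enorm (y - t).
  apply/eqP; rewrite eq_le dist_le //=.
  apply: lb_le_inf; first by exists (enorm (y - t)), t.
  move=> _ [s sS <-]; rewrite !enormE ler_sqrt ?dot_ge0 //.
  apply: ler_sum => i _; rewrite !mxE -!expr2.
  have := sS i; have [y0|y0] := leP 0 (y i 0) => si; last first.
    by rewrite subrr expr0n sqr_ge0.
  by rewrite ler_sqr ?nnegrE; lra.
rewrite enorm_sqr; apply: eq_bigr => i _; rewrite !mxE.
by have [y0|y0] := leP 0 (y i 0); rewrite ?subr0 ?subrr ?expr2 ?mul0r.
Qed.

(** * Minimizing the augmented function over an abstract set *)

Definition aug (R : realType) (m : nat) (rho : R) (lam : 'cV[R]_m)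
    (v : R) (w : 'cV[R]_m) : R :=
  v + dot lam w + rho / 2 * dot w w.

(* [g] is the infimum of the augmented function over [Z] and [w] the limit of
   the w-components of minimizing sequences.  Closing the second clause under
   linear perturbations [u] at [w] expresses this convergence without limits. *)
Definition center (R : realType) (m : nat) (rho : R)
    (Z : R -> 'cV[R]_m -> Prop) (lam : 'cV[R]_m) (g : R) (w : 'cV[R]_m) :=
  (forall v' w', Z v' w' ->
     g + rho / 2 * dot (w' - w) (w' - w) <= aug rho lam v' w') /\
  (forall q u, (forall v' w', Z v' w' ->
     q <= aug rho lam v' w' + dot u (w' - w)) -> q <= g).

(** Along a minimizing sequence for [lam2] the lower bound at [lam1] passes to the limit; the two
    augmented functions differ only by a term linear in [w]. *)
Lemma center_le (R : realType) (m : nat) (rho : R)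
    (Z : R -> 'cV[R]_m -> Prop) (lam1 lam2 : 'cV[R]_m) (g1 g2 : R)
    (w1 w2 : 'cV[R]_m) :
  0 < rho -> center rho Z lam1 g1 w1 -> center rho Z lam2 g2 w2 ->
  g1 + rho / 2 * dot (w2 - w1) (w2 - w1) <= g2 + dot (lam1 - lam2) w2.
Proof.
move=> rho0 [low1 _] [_ app2]; rewrite -lerBlDr.
(* This [u] cancels the terms linear in [w - w2]: [lam1 - lam2] comes from the change of multiplier,
   [rho *: (w2 - w1)] from expanding the square around [w2]. A nonnegative square of [w - w2]
   remains. *)
apply: (app2 _ (lam1 - lam2 - rho *: (w2 - w1))) => v w /low1.
have : 0 <= rho * dot (w - w2) (w - w2) by rewrite mulr_ge0 ?dot_ge0 ?ltW.
rewrite /aug !dotE (dotC w1 w) (dotC w2 w) (dotC w2 w1); lra.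
Qed.

(** Adding [center_le] to itself with the roles exchanged cancels [g1] and [g2]. With [w] read as a
    gradient, this is cocoercivity of the negative gradient. *)
Lemma center_monotone (R : realType) (m : nat) (rho : R)
    (Z : R -> 'cV[R]_m -> Prop) (lam1 lam2 : 'cV[R]_m) (g1 g2 : R)
    (w1 w2 : 'cV[R]_m) :
  0 < rho -> center rho Z lam1 g1 w1 -> center rho Z lam2 g2 w2 ->
  rho * dot (w1 - w2) (w1 - w2) <= - dot (lam1 - lam2) (w1 - w2).
Proof.
move=> rho0 c1 c2; have := center_le rho0 c1 c2; have := center_le rho0 c2 c1.
rewrite !dotE (dotC w2 w1); lra.
Qed.

Lemma center_lipschitz (R : realType) (m : nat) (rho : R)
    (Z : R -> 'cV[R]_m -> Prop) (lam1 lam2 : 'cV[R]_m) (g1 g2 : R)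
    (w1 w2 : 'cV[R]_m) :
  0 < rho -> center rho Z lam1 g1 w1 -> center rho Z lam2 g2 w2 ->
  rho * enorm (w1 - w2) <= enorm (lam1 - lam2).
Proof.
move=> rho0 c1 c2; have := center_monotone rho0 c1 c2.
rewrite -dotNl -enorm_sqr => /le_trans/(_ (dot_le_enorm _ _)).
rewrite enormN; have := enorm_ge0 (w1 - w2); have := enorm_ge0 (lam1 - lam2).
move: (enorm (lam1 - lam2)) (enorm (w1 - w2)) => a b a0 b0.
have [->|bn0] := eqVneq b 0.
  by rewrite !mulr0.
by rewrite expr2 mulrA ler_pM2r // lt_def bn0.
Qed.

(** The map is the proximal-point step of the dual. In the expanded square, monotonicity makes the
    cross term negative enough to absorb the square of [rho *: (w1 - w2)]. *)
Lemma center_step_nonexpansive (R : realType) (m : nat) (rho : R)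
    (Z : R -> 'cV[R]_m -> Prop) (lam1 lam2 : 'cV[R]_m) (g1 g2 : R)
    (w1 w2 : 'cV[R]_m) :
  0 < rho -> center rho Z lam1 g1 w1 -> center rho Z lam2 g2 w2 ->
  enorm ((lam1 + rho *: w1) - (lam2 + rho *: w2)) <= enorm (lam1 - lam2).
Proof.
move=> rho0 c1 c2.
rewrite -ler_sqr ?nnegrE ?enorm_ge0 // !enorm_sqr.
have := center_monotone rho0 c1 c2.
have -> : lam1 + rho *: w1 - (lam2 + rho *: w2)
    = (lam1 - lam2) + rho *: (w1 - w2).
  by rewrite scalerBr opprD addrACA.
have := dot_ge0 (w1 - w2); move: (w1 - w2) (lam1 - lam2) => w l.
rewrite !dotE (dotC w l); move: (dot w w) (dot l w) => a b; nra.
Qed.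

(** Completing the square in [w]: an affine minorant for one multiplier [mu] bounds the augmented
    function from below for every [lam]. *)
Lemma aug_bounded_below (R : realType) (m : nat) (rho c : R)
    (lam mu : 'cV[R]_m) (v : R) (w : 'cV[R]_m) :
  0 < rho -> c <= v + dot mu w ->
  c - (2 * rho)^-1 * dot (lam - mu) (lam - mu) <= aug rho lam v w.
Proof.
move=> rho0; have rho1 : rho != 0 by rewrite gt_eqF.
have : 0 <= rho / 2 * dot (w + rho^-1 *: (lam - mu)) (w + rho^-1 *: (lam - mu)).
  by rewrite mulr_ge0 ?dot_ge0 // divr_ge0 ?ltW.
have -> : rho / 2 * dot (w + rho^-1 *: (lam - mu)) (w + rho^-1 *: (lam - mu))
  = rho / 2 * dot w w + dot (lam - mu) w
    + (2 * rho)^-1 * dot (lam - mu) (lam - mu).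
  by move: (lam - mu) => l; rewrite !dotE (dotC w l); field.
rewrite /aug dotDl dotNl; lra.
Qed.

Lemma aug_strongly_convex (R : realType) (m : nat) (rho t : R)
    (lam : 'cV[R]_m) (v1 v2 : R) (w1 w2 : 'cV[R]_m) :
  aug rho lam (t * v1 + (1 - t) * v2) (t *: w1 + (1 - t) *: w2)
  = t * aug rho lam v1 w1 + (1 - t) * aug rho lam v2 w2
    - rho / 2 * (t * (1 - t)) * dot (w1 - w2) (w1 - w2).
Proof. by rewrite /aug !dotE (dotC w2 w1); ring. Qed.

(** * Existence of centers *)

Lemma cvg_dot (R : realType) (m : nat) (a b : nat -> 'cV[R]_m) (u v : 'cV[R]_m) :
  (forall i, (fun n => a n i 0) @ \oo --> u i 0) ->
  (forall i, (fun n => b n i 0) @ \oo --> v i 0) ->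
  (fun n => dot (a n) (b n)) @ \oo --> dot u v.
Proof.
move=> au bv; rewrite /dot; apply: cvg_big => [|i _].
  exact: add_continuous.
apply: cvgM; [exact: au|exact: bv].
Qed.

Lemma cvgn_of_sqr_dist (R : realType) (a : nat -> R) (K : R) :
  0 < K ->
  (forall n p, (a n - a p) ^+ 2 <= K * (n.+1%:R^-1 + p.+1%:R^-1)) -> cvgn a.
Proof.
move=> K0 aK; apply/cauchy_cvgP/cauchy_exP => e e0.
have e20 : 0 < e ^+ 2 / (2 * K) by rewrite divr_gt0 ?exprn_gt0 // mulr_gt0.
have [N _ NP] := near_infty_natSinv_lt (PosNum e20).
exists (a N); exists N => // n /= Nn; rewrite /ball /=.
rewrite -ltr_sqr ?nnegrE ?(ltW e0) // real_normK ?num_real //.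
apply: le_lt_trans (aK _ _) _.
have h1 := NP N (leqnn N); have h2 := NP n Nn; rewrite /= in h1 h2.
have -> : e ^+ 2 = K * (e ^+ 2 / (2 * K) + e ^+ 2 / (2 * K)).
  by field; rewrite gt_eqF.
by rewrite ltr_pM2l // ltrD.
Qed.

(* Strong convexity in [w] makes minimizing sequences Cauchy. *)
Lemma center_exists (R : realType) (m : nat) (rho : R)
    (Z : R -> 'cV[R]_m -> Prop) (mu : 'cV[R]_m) (c : R) :
  0 < rho -> (exists v w, Z v w) ->
  (forall (t : R) v1 w1 v2 w2, 0 <= t <= 1 -> Z v1 w1 -> Z v2 w2 ->
     Z (t * v1 + (1 - t) * v2) (t *: w1 + (1 - t) *: w2)) ->
  (forall v w, Z v w -> c <= v + dot mu w) ->
  forall lam, exists g w, center rho Z lam g w.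
Proof.
move=> rho0 [v0 [w0 Z0]] Zconv Zlow lam.
pose E := [set e | exists v w, Z v w /\ e = aug rho lam v w].
have infE : has_inf E.
  split; first by exists (aug rho lam v0 w0), v0, w0.
  exists (c - (2 * rho)^-1 * dot (lam - mu) (lam - mu)) => _ [v [w [Zvw ->]]].
  exact/aug_bounded_below/Zlow.
have [g g_le g_app] : exists2 g, (forall v w, Z v w -> g <= aug rho lam v w)
    & forall n : nat, exists z : R * 'cV[R]_m,
        Z z.1 z.2 /\ aug rho lam z.1 z.2 <= g + n.+1%:R^-1.
  exists (inf E) => [v w Zvw|n].
    by apply: ge_inf; [case: infE|exists v, w].
  have [|_ [v [w [Zvw ->]]] lt] := @inf_adherent _ E n.+1%:R^-1 _ infE.
    by rewrite invr_gt0.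
  by exists (v, w); split=> //; exact: ltW.
have [z zP] := choice g_app.
(* Test the infimum [g] at a convex combination of an arbitrary point and a near-minimizer, keeping
   the strong convexity gain. *)
have strong (t : R) v w n : 0 <= t <= 1 -> Z v w ->
    g <= t * aug rho lam v w + (1 - t) * (g + n.+1%:R^-1)
         - rho / 2 * (t * (1 - t)) * dot (w - (z n).2) (w - (z n).2).
  move=> t01 Zvw; have [Zn zn] := zP n.
  have := g_le _ _ (Zconv _ _ _ _ _ t01 Zvw Zn); rewrite aug_strongly_convex.
  move=> /le_trans; apply; rewrite lerD2r lerD2l ler_wpM2l //.
  by case/andP: t01; lra.
have cz i : cvgn (fun n => (z n).2 i 0).
  apply: (@cvgn_of_sqr_dist _ _ (4 / rho)); first exact: divr_gt0.
  move=> n p; have [Zn zn] := zP n.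
  (* The midpoint of two near-minimizers yields the constant [4 / rho]. *)
  have := strong 2^-1 _ _ p _ Zn => /(_ _)/wrap[]; first by lra.
  have : ((z n).2 i 0 - (z p).2 i 0) ^+ 2
      <= dot ((z n).2 - (z p).2) ((z n).2 - (z p).2).
    rewrite /dot (bigD1 i) //= !mxE -expr2 lerDl.
    by apply: sumr_ge0 => j _; rewrite -expr2 sqr_ge0.
  move: (dot _ _) (_ ^+ 2) => D d dD st.
  apply: le_trans dD _; rewrite mulrAC ler_pdivlMr //.
  by move: (aug _ _ _ _) n.+1%:R^-1 p.+1%:R^-1 st zn => a e1 e2 st zn; lra.
have [w zw] : exists w : 'cV[R]_m,
    forall i, (fun n => (z n).2 i 0) @ \oo --> w i 0.
  by exists (\col_i limn (fun n => (z n).2 i 0)) => i; rewrite mxE; exact: cz.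
exists g, w; split=> [v' w' Zvw|q u qP].
  have dist_cvg : (fun n => dot (w' - (z n).2) (w' - (z n).2)) @ \oo
      --> dot (w' - w) (w' - w).
    have cvgi i : (fun n => (w' - (z n).2) i 0) @ \oo --> (w' - w) i 0.
      rewrite !mxE; under eq_fun do rewrite !mxE.
      by apply: cvgB; [exact: cvg_cst|exact: zw].
    by apply: cvg_dot.
  have lim t : 0 <= t <= 1 -> g <= t * aug rho lam v' w' + (1 - t) * g
         - rho / 2 * (t * (1 - t)) * dot (w' - w) (w' - w).
    move=> t01; apply: (@cvgr_to_ge _ \oo _ _
      (fun n => t * aug rho lam v' w' + (1 - t) * (g + n.+1%:R^-1)
         - rho / 2 * (t * (1 - t)) * dot (w' - (z n).2) (w' - (z n).2))).
      apply: cvgB; last by apply: cvgM => //; exact: cvg_cst.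
      apply: cvgD; first exact: cvg_cst.
      apply: cvgM; first exact: cvg_cst.
      rewrite -[X in _ --> X]addr0.
      by apply: cvgD; [exact: cvg_cst|exact: cvg_harmonic].
    by apply: nearW => n; exact: strong.
  set P := rho / 2 * _; have P0 : 0 <= P.
    by rewrite mulr_ge0 ?dot_ge0 ?divr_ge0 ?ltW.
  apply/ler_addgt0Pr => e e0.
  (* This stands in for dividing by [t] and letting [t] tend to 0: the choice gives [t * P <= e]. *)
  pose t := e / (P + e).
  have Pe : 0 < P + e by lra.
  have t0 : 0 < t by rewrite divr_gt0.
  have t1 : t <= 1 by rewrite ler_pdivrMr //; lra.
  have tP : t * (P + e) = e by rewrite divfK ?gt_eqF.
  have := lim t; rewrite (ltW t0) t1 => /(_ isT).
  have -> : rho / 2 * (t * (1 - t)) * dot (w' - w) (w' - w) = t * ((1 - t) * P).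
    by rewrite /P; ring.
  move=> h; have : t * (g + (1 - t) * P) <= t * aug rho lam v' w' by lra.
  rewrite ler_pM2l //; nra.
(* Along the minimizing sequence the linear perturbation tends to 0. *)
apply: (@cvgr_to_ge _ \oo _ _
  (fun n => g + n.+1%:R^-1 + dot u ((z n).2 - w))).
  rewrite -[X in _ --> X]addr0; apply: cvgD.
    rewrite -[X in _ --> X]addr0.
    by apply: cvgD; [exact: cvg_cst|exact: cvg_harmonic].
  rewrite -(dot0r u); apply: cvg_dot => i; first exact: cvg_cst.
  rewrite mxE -(subrr (w i 0)); under eq_fun do rewrite !mxE.
  by apply: cvgB => //; exact: cvg_cst.
apply: nearW => n; have [Zn zn] := zP n.
by apply: le_trans (qP _ _ Zn) _; rewrite lerD2r.
Qed.

(** * Centers as gradients *)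

Lemma gradient_eq (R : realType) (m : nat) (phi : 'cV[R]_m -> R)
    (lam w : 'cV[R]_m) (K : R) :
  (forall u, `|phi (u + lam) - phi lam - dot u w| <= K * dot u u) ->
  gradient phi lam = w.
Proof.
move=> phiP; apply/matrixP => j i; rewrite ord1 mxE {i}.
set d := delta_mx j 0; have d1 : dot d d = 1 by rewrite dot_delta mxE !eqxx.
rewrite /derive; apply: cvg_lim => //; apply/cvgrPdist_le => e e0.
have K0 : 0 <= K by have := phiP d; rewrite d1 mulr1; apply: le_trans.
(* Using [K + 1] keeps the radius defined when [K = 0]. *)
have eK : 0 < e / (K + 1) by rewrite divr_gt0 // ltr_wpDl.
near=> t.
have t0 : t != 0 by near: t; exact: nbhs_dnbhs_neq.
have tK : `|t| < e / (K + 1).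
  near: t; apply: dnbhs0_lt; exact: eK.
have := phiP (t *: d); rewrite /= !dotZl dotZr d1 mulr1 dot_delta => h.
rewrite distrC /GRing.scale /=.
have -> : t^-1 * (phi (t *: d + lam) - phi lam) - w j 0
    = t^-1 * (phi (t *: d + lam) - phi lam - t * w j 0) by field.
rewrite normrM normfV ler_pdivrMl ?normr_gt0 //.
apply: (le_trans h); rewrite -[t * t]ger0_norm -?expr2 ?sqr_ge0 // normrX.
rewrite expr2 mulrCA ler_wpM2l //.
have K1 : 0 < K + 1 by rewrite ltr_wpDl.
move: tK; rewrite ltr_pdivlMr // mulrDr mulr1 => tK.
by have := normr_ge0 t; move: `|t| tK => s; lra.
Unshelve. all: by end_near.
Qed.

(** The two instances of [center_le] at [lam] and [u + lam] put the linearization error between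
    [- (2 * rho)^-1 * dot u u] and 0; the lower bound completes a square in [e = w - w']. *)
Lemma gradient_center (R : realType) (m : nat) (rho : R)
    (Z : R -> 'cV[R]_m -> Prop) (F : 'cV[R]_m -> \bar R)
    (lam : 'cV[R]_m) (g : R) (w : 'cV[R]_m) :
  0 < rho ->
  (forall l, exists g' w', center rho Z l g' w' /\ F l = g'%:E) ->
  center rho Z lam g w -> F lam = g%:E ->
  gradient (fun l => fine (F l)) lam = w.
Proof.
move=> rho0 FP c Fg; apply: (@gradient_eq _ _ _ _ _ (2 * rho)^-1) => u.
have [g' [w' [c' ->]]] := FP (u + lam); rewrite Fg /=.
have := center_le rho0 c' c; have := center_le rho0 c c'.
have -> : u + lam - lam = u by rewrite addrK.
have -> : lam - (u + lam) = - u by rewrite opprD addrC subrK.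
rewrite -(opprB w w') !(dotNl (w - w')) !(dotNr (w - w')) opprK => h1 h2.
have uw : dot u w' = dot u w - dot u (w - w') by rewrite !dotE; ring.
move: h1 h2; rewrite dotNl uw; move: (w - w') => e h1 h2.
have e2 := dot_ge0 e; have re2 := mulr_ge0 (ltW rho0) e2.
have : 0 <= rho / 2 * dot (e - rho^-1 *: u) (e - rho^-1 *: u).
  by rewrite mulr_ge0 ?dot_ge0 // divr_ge0 ?ltW.
have -> : rho / 2 * dot (e - rho^-1 *: u) (e - rho^-1 *: u)
    = rho / 2 * dot e e - dot u e + (2 * rho)^-1 * dot u u.
  by rewrite !dotE (dotC e u); field; rewrite gt_eqF.
have : 0 <= (2 * rho)^-1 * dot u u.
  by rewrite mulr_ge0 ?dot_ge0 // invr_ge0 mulr_ge0 ?ltW.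
move: (_^-1 * dot u u) => U U0 hU.
rewrite ler_norml; apply/andP; split; lra.
Qed.

(** * The augmented Lagrangian as a minimum over slack variables *)

(* The minimizer over [w >= y] of [dot lam w + rho / 2 * dot w w]. *)
Definition slack (R : realType) (m : nat) (rho : R) (lam y : 'cV[R]_m) :
  'cV[R]_m := \col_i Num.max (y i 0) (- (lam i 0 / rho)).

Lemma slack_ge (R : realType) (m : nat) (rho : R) (lam y : 'cV[R]_m) i :
  y i 0 <= slack rho lam y i 0.
Proof. by rewrite mxE le_max lexx. Qed.

(** Coordinatewise, either [s] is the unconstrained minimizer and equality holds, or [s] is the
    bound [y], where the derivative is positive and [w - y] nonnegative. *)
Lemma slack_sharp (R : realType) (m : nat) (rho : R) (lam y w : 'cV[R]_m)
    (s := slack rho lam y) :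
  0 < rho -> (forall i, y i 0 <= w i 0) ->
  dot lam s + rho / 2 * dot s s + rho / 2 * dot (w - s) (w - s)
  <= dot lam w + rho / 2 * dot w w.
Proof.
move=> rho0 yw; rewrite /dot !mulr_sumr -!big_split /=.
apply: ler_sum => i _; rewrite !mxE.
move: (lam i 0) (y i 0) (w i 0) (yw i) => l a b ab.
have rl : rho * (l / rho) = l by rewrite mulrCA divff ?mulr1 ?gt_eqF.
move: (l / rho) rl => c <-; have [ac|ac] := leP a (- c); first lra.
have : 0 <= rho * ((c + a) * (b - a)).
  by rewrite mulr_ge0 ?(ltW rho0) // mulr_ge0 ?subr_ge0 //; lra.
by lra.
Qed.

(** With [c = l / rho], both sides reduce in each coordinate to [rho / 2] times the square of
    [max 0 (c + y)] minus the square of [c]. *)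
Lemma lagrangian_slack (R : realType) (n d m : nat)
    (f : 'cV[R]_n -> 'cV[R]_d -> \bar R) (h : 'cV[R]_n -> 'cV[R]_d -> 'cV[R]_m)
    (rho : R) (x : 'cV[R]_n) (lam : 'cV[R]_m) (theta : 'cV[R]_d)
    (s := slack rho lam (h x theta)) :
  0 < rho ->
  lagrangian f h rho x lam theta
  = (f x theta + (dot lam s + rho / 2 * dot s s)%:E)%E.
Proof.
move=> rho0; rewrite /lagrangian gt_eqF // -addeA -EFinB; congr (_ + _%:E)%E.
rewrite dist_nonpos_sqr enorm_sqr /dot mulr_suml !mulr_sumr -sumrB -big_split /=.
apply: eq_bigr => i _; rewrite !mxE.
move: (lam i 0) (h x theta i 0) => l y.
have -> : l * l / (2 * rho) = rho * (l / rho) * (l / rho) / 2.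
  by field; rewrite gt_eqF.
rewrite [rho^-1 * l]mulrC; have : rho * (l / rho) = l.
  by rewrite mulrCA divff ?mulr1 ?gt_eqF.
move: (l / rho) => c <-.
have [cy|cy] := leP 0 (c + y); have [yc|yc] := leP y (- c); try lra.
have -> : y = - c by lra.
by field.
Qed.

(** * The perturbation epigraph and the dual function *)

(* The epigraph of the perturbation function of the convex program. *)
Definition epi (R : realType) (n d m : nat) (X : set 'cV[R]_n)
    (f : 'cV[R]_n -> 'cV[R]_d -> \bar R) (h : 'cV[R]_n -> 'cV[R]_d -> 'cV[R]_m)
    (theta : 'cV[R]_d) (v : R) (w : 'cV[R]_m) : Prop :=
  exists x, [/\ X x, (f x theta <= v%:E)%E & forall i, h x theta i 0 <= w i 0].

Lemma lagrangian_le_aug (R : realType) (n d m : nat)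
    (f : 'cV[R]_n -> 'cV[R]_d -> \bar R) (h : 'cV[R]_n -> 'cV[R]_d -> 'cV[R]_m)
    (rho : R) (x : 'cV[R]_n) (lam : 'cV[R]_m) (theta : 'cV[R]_d)
    (v : R) (w : 'cV[R]_m) :
  0 < rho -> (f x theta <= v%:E)%E -> (forall i, h x theta i 0 <= w i 0) ->
  (lagrangian f h rho x lam theta <= (aug rho lam v w)%:E)%E.
Proof.
move=> rho0 fv hw; rewrite lagrangian_slack //.
rewrite /aug -addrA [leRHS]EFinD; apply: leeD => //; rewrite lee_fin.
apply: le_trans (slack_sharp lam rho0 hw); rewrite lerDl.
by rewrite mulr_ge0 ?dot_ge0 // divr_ge0 // ltW.
Qed.

Lemma dual_function_center (R : realType) (n d m : nat) (X : set 'cV[R]_n)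
    (f : 'cV[R]_n -> 'cV[R]_d -> \bar R) (h : 'cV[R]_n -> 'cV[R]_d -> 'cV[R]_m)
    (rho : R) (lam : 'cV[R]_m) (theta : 'cV[R]_d)
    (g : R) (w : 'cV[R]_m) :
  0 < rho -> (forall x, X x -> f x theta != -oo%E) ->
  center rho (epi X f h theta) lam g w ->
  dual_function X f h rho lam theta = g%:E.
Proof.
move=> rho0 fN [low app]; apply/eqP; rewrite eq_le; apply/andP; split.
  set D := dual_function _ _ _ _ _ _.
  have DP v w' : epi X f h theta v w' -> (D <= (aug rho lam v w')%:E)%E.
    move=> [x [Xx fv hw]]; apply: le_trans (lagrangian_le_aug lam rho0 fv hw).
    by apply: ereal_inf_lbound; exists x.
  have {}app q : (q%:E <= D)%E -> q <= g.
    move=> qD; apply: (app q 0) => v w' /DP Dv.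
    by rewrite dot0l addr0 -lee_fin (le_trans qD).
  (* The value [+oo] is excluded, since it would give [g + 1 <= g]. *)
  case: D app {DP} => [r||] app; rewrite ?leNye //.
    by rewrite lee_fin app.
  by have := app (g + 1) (leey _); rewrite gerDl ler10.
apply/ereal_infP => _ [x Xx <-]; rewrite lagrangian_slack //.
case fx : (f x theta) (fN x Xx) => [v||] // _; last by rewrite addye ?leey.
rewrite -EFinD lee_fin addrA; set s := slack _ _ _.
apply: le_trans (low v s _).
  by rewrite lerDl mulr_ge0 ?dot_ge0 // divr_ge0 ?ltW.
by exists x; split; rewrite ?fx //; exact: slack_ge.
Qed.

(** For the one-point set [[set x]] the dual function is the Lagrangian itself, and its center is
    explicit because the minimum is attained at the slack. *)
Lemma grad_lagrangianE (R : realType) (n d m : nat)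
    (f : 'cV[R]_n -> 'cV[R]_d -> \bar R) (h : 'cV[R]_n -> 'cV[R]_d -> 'cV[R]_m)
    (rho : R) (x : 'cV[R]_n) (lam : 'cV[R]_m) (theta : 'cV[R]_d)
    (v : R) :
  0 < rho -> f x theta = v%:E ->
  grad_lagrangian f h rho x lam theta = slack rho lam (h x theta).
Proof.
move=> rho0 fx; pose s l := slack rho l (h x theta).
have c l : center rho (epi [set x] f h theta) l (aug rho l v (s l)) (s l).
  split=> [v' w' [_ [-> fv hw]]|q u qP].
    have := slack_sharp l rho0 hw; move: fv; rewrite fx lee_fin /aug -/(s l).
    by move=> ? /= ?; lra.
  have := qP v (s l); rewrite subrr dot0r addr0; apply.
  by exists x; split; rewrite ?fx //; exact: slack_ge.
have FE l : lagrangian f h rho x l theta = (aug rho l v (s l))%:E.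
  by rewrite lagrangian_slack // fx -EFinD addrA.
apply: gradient_center (c lam) (FE lam) => // l.
by exists (aug rho l v (s l)), (s l); split.
Qed.

Lemma grad_dualE (R : realType) (n d m : nat) (X : set 'cV[R]_n)
    (f : 'cV[R]_n -> 'cV[R]_d -> \bar R) (h : 'cV[R]_n -> 'cV[R]_d -> 'cV[R]_m)
    (rho : R) (lam : 'cV[R]_m) (theta : 'cV[R]_d)
    (g : R) (w : 'cV[R]_m) :
  0 < rho -> (forall x, X x -> f x theta != -oo%E) ->
  (forall l, exists g' w', center rho (epi X f h theta) l g' w') ->
  center rho (epi X f h theta) lam g w ->
  grad_dual X f h rho lam theta = w.
Proof.
move=> rho0 fN cP c.
apply: gradient_center c (dual_function_center rho0 fN c) => // l.
have [g' [w' c']] := cP l; exists g', w'; split=> //.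
exact: dual_function_center c'.
Qed.

Lemma epi_convex (R : realType) (n d m : nat) (X : set 'cV[R]_n)
    (f : 'cV[R]_n -> 'cV[R]_d -> \bar R) (h : 'cV[R]_n -> 'cV[R]_d -> 'cV[R]_m)
    (theta : 'cV[R]_d) (A : 'M[R]_(m, n)) (b : 'cV[R]_m) :
  convex_set X -> econvex_function X (f^~ theta) ->
  (forall x, h x theta = A *m x + b) ->
  forall (t : R) v1 w1 v2 w2, 0 <= t <= 1 ->
    epi X f h theta v1 w1 -> epi X f h theta v2 w2 ->
    epi X f h theta (t * v1 + (1 - t) * v2) (t *: w1 + (1 - t) *: w2).
Proof.
move=> Xconv fconv hE t v1 w1 v2 w2 t01 [x1 [X1 f1 h1]] [x2 [X2 f2 h2]].
have /andP[t0 t1] := t01; have t1' : 0 <= 1 - t by rewrite subr_ge0.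
exists (t *: x1 + (1 - t) *: x2); split.
- by have := Xconv x1 x2 (Itv01 t0 t1); rewrite !inE; apply.
- apply: le_trans (fconv t x1 x2 t01 X1 X2) _; rewrite [leRHS]EFinD !EFinM.
  by apply: leeD; apply: lee_wpmul2l; rewrite ?lee_fin.
- move=> i; have := h1 i; have := h2 i.
  rewrite !hE mulmxDr -!scalemxAr !mxE.
  move: ((A *m x1) i 0) ((A *m x2) i 0) (b i 0) (w1 i 0) (w2 i 0) => a1 a2 c d1 d2.
  by move=> hd2 hd1; have := ler_wpM2l t0 hd1; have := ler_wpM2l t1' hd2; lra.
Qed.

Lemma affine_mean (R : realType) (m n k : nat) (A : 'M[R]_(m, n)) (b : 'cV[R]_m)
    (x : nat -> 'cV[R]_n) :
  A *m ((k.+1%:R)^-1 *: \sum_(i < k.+1) x i) + b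
  = (k.+1%:R)^-1 *: \sum_(i < k.+1) (A *m x i + b).
Proof.
rewrite big_split /= sumr_const card_ord scalerDr -[b *+ _]scaler_nat scalerA.
by rewrite mulVf ?pnatr_eq0 // scale1r -scalemxAr mulmx_sumr.
Qed.

(** * Centers at dual solutions *)

(* Weak duality and the absence of a gap make [(f_star, 0)] the minimizer at a
   dual solution. *)
Lemma center_dual_solution (R : realType) (n d m : nat) (X : set 'cV[R]_n)
    (f : 'cV[R]_n -> 'cV[R]_d -> \bar R) (h : 'cV[R]_n -> 'cV[R]_d -> 'cV[R]_m)
    (theta : 'cV[R]_d) (f_star rho : R) (lam : 'cV[R]_m) :
  optimal_value X f h theta = f_star%:E ->
  (forall v w, epi X f h theta v w -> f_star <= v + dot lam w) ->
  center rho (epi X f h theta) lam f_star 0.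
Proof.
move=> optE low; split=> [v w Zvw|q u qP].
  by rewrite subr0 /aug lerD2r low.
apply/ler_addgt0Pr => e e0; rewrite /optimal_value in optE.
have [|_ [x [Xx hx] <-]] := @lb_ereal_inf_adherent _
  [set f x theta | x in X `&` [set x | nonpos_orthant (h x theta)]] e e0.
  by rewrite optE.
rewrite optE -EFinD => fx; have /qP : epi X f h theta (f_star + e) 0.
  by exists x; split=> // [|i]; [exact: ltW|rewrite mxE; exact: hx].
by rewrite /aug subrr !dot0r mulr0 !addr0.
Qed.

Lemma dual_solution_bound (R : realType) (n d m : nat) (X : set 'cV[R]_n)
    (f : 'cV[R]_n -> 'cV[R]_d -> \bar R) (h : 'cV[R]_n -> 'cV[R]_d -> 'cV[R]_m)
    (theta : 'cV[R]_d) (f_star : R) (lam : 'cV[R]_m) :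
  X !=set0 ->
  (f_star%:E <= dual_function X f h 0 lam theta)%E ->
  forall v w, epi X f h theta v w -> f_star <= v + dot lam w.
Proof.
move=> [x0 X0] /ereal_infP lowL.
have lowf x : X x -> (f_star%:E <= lagrangian f h 0 x lam theta)%E.
  by move=> Xx; apply: lowL; exists x.
(* Otherwise the Lagrangian at [x0] would be [-oo], below the finite [f_star]. *)
have lam0 : nonneg_orthant lam.
  have := lowf _ X0; rewrite /lagrangian eqxx; case: ifPn => [|//].
  by rewrite inE.
move=> v w [x [Xx fv hw]]; have := lowf _ Xx.
rewrite /lagrangian eqxx mem_set // => /le_trans/(_ (leeD2r _ fv)).
rewrite -EFinD lee_fin => /le_trans; apply; rewrite lerD2l !mxE.
apply: ler_sum => i _; rewrite !mxE ler_wpM2l //; exact: lam0.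
Qed.

(** * Scalar estimates for the rate *)

Lemma sum_geometric_le (R : realType) (q : R) (k : nat) :
  0 < q < 1 -> \sum_(i < k) q ^+ i <= (1 - q)^-1.
Proof.
move=> /andP[q0 q1].
have := @geometric_le_lim R k 1 q ler01 q0; rewrite ger0_norm ?(ltW q0) //.
move=> /(_ q1); rewrite mul1r /series /= big_mkord.
by apply: le_trans; apply: ler_sum => i _; rewrite /= mul1r.
Qed.

(** Here [L] is the norm of the dual solution and [T] the accumulated error. The radicand is at
    least twice the square of [L / rho]; for [k >= 1] the factor [k.+1 >= 2] pays for [2 * L], while
    [k = 0] needs the sharper bound. *)
Lemma multiplier_rate (R : realType) (rho L T nrm : R) (k : nat)
    (C := T + L) (B := 1 / (2 * rho) * L ^+ 2 + C * (T / rho)) :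
  0 < rho -> 0 <= L -> 0 <= T -> nrm <= 2 * L + T ->
  (k = 0%N -> nrm <= L + T) ->
  nrm / rho <= Num.sqrt (2 * B / rho + (C / rho) ^+ 2) * Num.sqrt k.+1%:R
               + T / rho.
Proof.
move=> rho0 L0 T0 nrm2 nrm1.
have rhoN : rho != 0 by rewrite gt_eqF.
set D := 2 * B / rho + _.
have DE : D = (L ^+ 2 + 2 * C * T + C ^+ 2) / rho ^+ 2.
  by rewrite /D /B; field.
have D2 : 2 * (L / rho) ^+ 2 <= D.
  rewrite DE expr_div_n mulrA ler_pM2r ?invr_gt0 ?exprn_gt0 // /C; nra.
have D0 : 0 <= D by apply: le_trans D2; rewrite mulr_ge0 // sqr_ge0.
have L1 : 0 <= L / rho by rewrite divr_ge0 // ltW.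
rewrite -sqrtrM // -lerBlDr -mulrBl.
suff [a aE na] : exists2 a, a ^+ 2 <= D * k.+1%:R & (nrm - T) / rho <= a.
  apply: le_trans na _; apply: le_trans (ler_norm a) _.
  by rewrite -sqrtr_sqr ler_wsqrtr.
case: k nrm1 => [/(_ erefl) nrm1|k _].
  exists (L / rho); last by rewrite ler_pM2r ?invr_gt0 //; lra.
  by have := sqr_ge0 (L / rho); rewrite mulr1; lra.
exists (2 * (L / rho)); last by rewrite mulrA ler_pM2r ?invr_gt0 //; lra.
rewrite exprMn; apply: (@le_trans _ _ (D * 2)); first by lra.
by rewrite ler_wpM2l // ler_nat.
Qed.

(** * Convergence of the misspecified scheme *)

Theorem theorem3 (R : realType) (n d m : nat)
  (* problem *)
  (X : set 'cV[R]_n) (Theta : set 'cV[R]_d)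
  (f : 'cV[R]_n -> 'cV[R]_d -> \bar R)
  (h : 'cV[R]_n -> 'cV[R]_d -> 'cV[R]_m)
  (ell : 'cV[R]_d -> R) (theta_star : 'cV[R]_d) (f_star : R)
  (X_convex : convex_set X) (X_compact : compact X)
  (Theta_convex : convex_set Theta) (Theta_compact : compact Theta)
  (f_proper : forall x theta, Theta theta -> f x theta != -oo%E)
  (theta_star_argmin : argmin Theta ell = [set theta_star])
  (f_starE : optimal_value X f h theta_star = f_star%:E)
  (dual_solvable :
    argmax setT (fun lam => dual_function X f h 0 lam theta_star) !=set0)
  (no_duality_gap :
    ereal_sup (range (fun lam => dual_function X f h 0 lam theta_star))
    = optimal_value X f h theta_star)
  (* (i) *)
  (f_convex : forall theta, Theta theta -> econvex_function X (f^~ theta))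
  (h_convex : forall theta (j : 'I_m), Theta theta ->
    convex_function X (fun x => h x theta j 0))
  (* (ii) *)
  (L_f : R)
  (f_lipschitz : forall x theta1 theta2, X x -> Theta theta1 -> Theta theta2 ->
    (f x theta1 <= f x theta2 + (L_f * enorm (theta1 - theta2))%:E)%E)
  (* (iii) *)
  (A : 'cV[R]_d -> 'M[R]_(m, n)) (b : 'cV[R]_d -> 'cV[R]_m)
  (h_affine : forall x theta, Theta theta -> h x theta = A theta *m x + b theta)
  (A_lipschitz : exists L_A : R, forall theta1 theta2,
    Theta theta1 -> Theta theta2 ->
    enorm (A theta1 - A theta2) <= L_A * enorm (theta1 - theta2))
  (b_lipschitz : exists L_b : R, forall theta1 theta2,
    Theta theta1 -> Theta theta2 ->
    enorm (b theta1 - b theta2) <= L_b * enorm (theta1 - theta2))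
  (L_h : R)
  (h_lipschitz : forall x theta1 theta2, X x -> Theta theta1 -> Theta theta2 ->
    enorm (h x theta1 - h x theta2) <= L_h * enorm (theta1 - theta2))
  (sigma_h : R)
  (h_ball : forall theta, Theta theta ->
    [set h x theta | x in @unit_ball R n]
    `<=` [set sigma_h *: u | u in @unit_ball R m])
  (* (iv) *)
  (kappa_X : R)
  (argmin_lipschitz : forall (lam : 'cV[R]_m) theta1 theta2,
    nonneg_orthant lam -> Theta theta1 -> Theta theta2 ->
    lagrangian_argmin X f h lam theta1
    `<=` [set x + (kappa_X * enorm (theta1 - theta2)) *: u |
            x in lagrangian_argmin X f h lam theta2 & u in @unit_ball R n])
  (* (v) *)
  (theta : nat -> 'cV[R]_d) (q_ell : R)
  (theta_in : forall k, Theta (theta k))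
  (q_ell_in : 0 < q_ell < 1)
  (theta_cvg : forall k,
    enorm (theta k - theta_star) <= q_ell ^+ k * enorm (theta 0%N - theta_star))
  (* penalty parameter and constant M_h *)
  (rho : R) (rho_gt0 : 0 < rho)
  (M_h : R) (M_h_ge0 : 0 <= M_h)
  (grad_dual_lipschitz : forall (lam : 'cV[R]_m) theta1 theta2,
    Theta theta1 -> Theta theta2 ->
    enorm (grad_dual X f h rho lam theta1 - grad_dual X f h rho lam theta2)
    <= M_h * enorm (theta1 - theta2))
  (* misspecified inexact augmented Lagrangian scheme *)
  (alpha : nat -> R)
  (alpha_ge0 : forall k, 0 <= alpha k)
  (alpha_summable : cvgn (series (fun k => Num.sqrt (alpha k))))
  (x : nat -> 'cV[R]_n) (lambda : nat -> 'cV[R]_m)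
  (lambda0 : lambda 0%N = 0)
  (x_in : forall k, X (x k))
  (x_step : forall k,
    (lagrangian f h rho (x k) (lambda k) (theta k)
     <= dual_function X f h rho (lambda k) (theta k) + (alpha k)%:E)%E)
  (lambda_step : forall k,
    lambda k.+1
    = lambda k + rho *: grad_lagrangian f h rho (x k) (lambda k) (theta k))
  (lambda_star : 'cV[R]_m)
  (lambda_star_argmax :
    argmax setT (fun lam => dual_function X f h 0 lam theta_star) lambda_star) :
  let xbar := fun k : nat => (k.+1%:R)^-1 *: \sum_(i < k.+1) x i in
  let S := limn (series (fun i => Num.sqrt (alpha i))) in
  let e0 := enorm (theta 0%N - theta_star) in
  let C_lambda :=
    Num.sqrt (2 * rho) * S + rho * M_h * (e0 / (1 - q_ell))
    + enorm lambda_star in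
  let B_g :=
    1 / (2 * rho) * enorm lambda_star ^+ 2
    + C_lambda * (Num.sqrt (2 / rho) * S + M_h * e0 / (1 - q_ell)) in
  let C_1 := Num.sqrt (2 * B_g / rho + (C_lambda / rho) ^+ 2) in
  let C_2 := Num.sqrt (2 / rho) * S + (L_h + M_h) * e0 / (1 - q_ell) in
  forall k : nat,
    dist (@nonpos_orthant R m) (h (xbar k) theta_star)
    <= C_1 / Num.sqrt (k.+1%:R) + C_2 / k.+1%:R.
Proof.
move=> xbar S e0 C_lambda B_g C_1 C_2 k.
have rhoN : rho != 0 by rewrite gt_eqF.
have [q0 q1] := andP q_ell_in.
have q1' : 0 < 1 - q_ell by rewrite subr_gt0.
have ts_in : Theta theta_star.
  have : [set theta_star] theta_star by [].
  by rewrite -theta_star_argmin => -[].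
pose Z th := epi X f h th.
have e0_ge0 : 0 <= e0 by exact: enorm_ge0.
have dual_eq : dual_function X f h 0 lambda_star theta_star = f_star%:E.
  rewrite -f_starE -no_duality_gap; apply/eqP; rewrite eq_le; apply/andP; split.
    by apply: ereal_sup_ubound; exists lambda_star.
  apply/ereal_supP => _ [l _ <-]; exact: (lambda_star_argmax.2 l).
have low_star v w : Z theta_star v w -> f_star <= v + dot lambda_star w.
  by apply: dual_solution_bound; [exists (x 0%N)|rewrite dual_eq].
have c_star := center_dual_solution rho f_starE low_star.
have fN th : Theta th -> forall y, X y -> f y th != -oo%E.
  by move=> Tth y _; exact: f_proper.
(* The affine minorant at [theta_star] is carried over to [th]: the objective moves by at most
   [L_f * e], the constraint by at most [L_h * e]. *)
have centers th : Theta th -> forall l, exists g w, center rho (Z th) l g w.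
  move=> Tth; set e := enorm (theta_star - th).
  have eC : enorm (th - theta_star) = e by rewrite -enormN opprB.
  apply: (@center_exists _ _ _ _ lambda_star
    (f_star - L_f * e - enorm lambda_star * (L_h * e))) => //.
  - have := f_starE; rewrite /optimal_value => optE.
    have [|_ [y [Xy hy] <-]] := @lb_ereal_inf_adherent _
      [set f x theta_star | x in X `&` [set x | nonpos_orthant (h x theta_star)]]
      1 ltr01; first by rewrite optE.
    rewrite optE -EFinD => fy.
    exists (f_star + 1 + L_f * e), (h y th), y; split=> //.
    apply: le_trans (f_lipschitz _ _ _ Xy Tth ts_in) _.
    by rewrite eC [leRHS]EFinD leeD2r // ltW.
  - exact: (epi_convex X_convex (f_convex _ Tth) (fun y => h_affine y _ Tth)).
  - move=> v w [y [Xy fy hy]].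
    have : Z theta_star (v + L_f * e) (w + (h y theta_star - h y th)).
      exists y; split=> // [|i].
        apply: le_trans (f_lipschitz _ _ _ Xy ts_in Tth) _.
        by rewrite EFinD leeD2r.
      by rewrite !mxE; have := hy i; lra.
    move=> /low_star; rewrite dotDr.
    have := dot_le_enorm lambda_star (h y theta_star - h y th).
    have := h_lipschitz _ _ _ Xy ts_in Tth.
    move=> /(ler_wpM2l (enorm_ge0 lambda_star)).
    by rewrite -/e; lra.
pose w i := slack rho (lambda i) (h (x i) (theta i)).
have step i : exists g w',
    [/\ center rho (Z theta_star) (lambda i) g w',
        lambda i.+1 = lambda i + rho *: w i &
        enorm (lambda i.+1 - (lambda i + rho *: w'))
        <= Num.sqrt (2 * rho) * Num.sqrt (alpha i)
           + rho * M_h * (q_ell ^+ i * e0)].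
  have [g' [w' c']] := centers _ ts_in (lambda i).
  have [g [wi c]] := centers _ (theta_in i) (lambda i).
  have Ng := fN _ (theta_in i).
  have [v fv] : exists v, f (x i) (theta i) = v%:E.
    have := x_step i; rewrite (dual_function_center rho_gt0 Ng c).
    rewrite lagrangian_slack //.
    by case: (f _ _) (Ng _ (x_in i)) => [v||] // _; exists v.
  have lamE : lambda i.+1 = lambda i + rho *: w i.
    by rewrite lambda_step (grad_lagrangianE _ _ rho_gt0 fv).
  exists g', w'; split=> //; rewrite lamE.
  (* The error splits into inexact minimization, controlled by [alpha i] through the first clause of
     the center, and misspecification, controlled by [M_h] since [wi] and [w'] are dual
     gradients. *)
  have -> : lambda i + rho *: w i - (lambda i + rho *: w')
      = rho *: (w i - wi) + rho *: (wi - w').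
    by rewrite opprD addrACA subrr add0r -!scalerBr -scalerDr addrA subrK.
  apply: le_trans (enormD _ _) _; rewrite !enormZ ?(ltW rho_gt0) //.
  apply: lerD.
    rewrite -ler_sqr ?nnegrE ?mulr_ge0 ?enorm_ge0 ?sqrtr_ge0 ?(ltW rho_gt0) //.
    rewrite !exprMn enorm_sqr !sqr_sqrtr ?mulr_ge0 ?(ltW rho_gt0) //.
    have := c.1 v (w i) _ => /(_ _)/wrap[].
      by exists (x i); split; rewrite ?fv // => j; exact: slack_ge.
    have := x_step i; rewrite (dual_function_center rho_gt0 Ng c).
    rewrite lagrangian_slack // fv -!EFinD lee_fin /aug -/(w i) => h1 h2.
    have {h1 h2} : rho / 2 * dot (w i - wi) (w i - wi) <= alpha i by lra.
    move=> /(ler_wpM2l (ltW rho_gt0)); lra.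
  rewrite -mulrA ler_wpM2l ?(ltW rho_gt0) //.
  rewrite -(grad_dualE rho_gt0 Ng (centers _ (theta_in i)) c).
  rewrite -(grad_dualE rho_gt0 (fN _ ts_in) (centers _ ts_in) c').
  apply: le_trans (grad_dual_lipschitz _ _ _ (theta_in i) ts_in) _.
  by rewrite ler_wpM2l.
pose E := e0 / (1 - q_ell).
have E_ge0 : 0 <= E by rewrite divr_ge0 // ltW.
pose T := Num.sqrt (2 * rho) * S + rho * M_h * E.
have geom j : \sum_(i < j) q_ell ^+ i * e0 <= E.
  by rewrite -mulr_suml /E mulrC ler_wpM2l // sum_geometric_le.
have partial j : \sum_(i < j) (Num.sqrt (2 * rho) * Num.sqrt (alpha i)
    + rho * M_h * (q_ell ^+ i * e0)) <= T.
  rewrite big_split /= -!mulr_sumr; apply: lerD.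
    rewrite ler_wpM2l ?sqrtr_ge0 //.
    rewrite -(big_mkord xpredT (fun i => Num.sqrt (alpha i))).
    apply: nondecreasing_cvgn_le alpha_summable j.
    by apply: nondecreasing_series => i _ _; exact: sqrtr_ge0.
  by rewrite ler_wpM2l ?geom // mulr_ge0 // ltW.
have T_ge0 : 0 <= T by have := partial 0%N; rewrite big_ord0.
(* The exact step at [theta_star] is nonexpansive and fixes [lambda_star], whose center has [w = 0];
   only the step errors accumulate. *)
have lam_dist j : enorm (lambda j - lambda_star) <= enorm lambda_star
    + \sum_(i < j) (Num.sqrt (2 * rho) * Num.sqrt (alpha i)
                    + rho * M_h * (q_ell ^+ i * e0)).
  elim: j => [|j IH]; first by rewrite lambda0 sub0r enormN big_ord0 addr0.
  have [g [w' [c' _ err]]] := step j.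
  rewrite big_ord_recr /= addrA; apply: le_trans (lerD IH err).
  have := center_step_nonexpansive rho_gt0 c' c_star.
  rewrite scaler0 addr0 => ne.
  have := enormD (lambda j.+1 - (lambda j + rho *: w'))
                 (lambda j + rho *: w' - lambda_star).
  by rewrite addrA subrK => h1; lra.
have lam_bound : enorm (lambda k.+1) <= 2 * enorm lambda_star + T.
  have := lam_dist k.+1; have := partial k.+1.
  have := enormD (lambda k.+1 - lambda_star) lambda_star; rewrite subrK.
  by move=> *; lra.
(* From [lambda 0 = 0] the exact step is [rho *: w'], of norm at most [enorm lambda_star], so no
   detour through [lambda_star] is made. *)
have lam1_bound : k = 0%N -> enorm (lambda k.+1) <= enorm lambda_star + T.
  move=> ->; have [g [w' [c' _ err]]] := step 0%N.
  have := partial 1%N; rewrite big_ord1 => p1.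
  have := center_lipschitz rho_gt0 c' c_star.
  rewrite subr0 lambda0 sub0r enormN -enormZ ?(ltW rho_gt0) // => w'L.
  have := enormD (lambda 1%N - (lambda 0%N + rho *: w')) (rho *: w').
  rewrite lambda0 add0r subrK => h1; move: err; rewrite lambda0 add0r => err.
  by lra.
have rate := multiplier_rate rho_gt0 (enorm_ge0 lambda_star) T_ge0 lam_bound
  lam1_bound.
have sumw j : \sum_(i < j) w i = rho^-1 *: lambda j.
  elim: j => [|j IH]; first by rewrite big_ord0 lambda0 scaler0.
  have [_ [_ [_ -> _]]] := step j.
  by rewrite big_ord_recr /= IH scalerDr scalerA mulVf // scale1r.
(* This comparison point in the orthant leaves only the drift of [h] in the parameter and, by
   telescoping, [lambda k.+1 / rho]. *)
pose s := k.+1%:R^-1 *: \sum_(i < k.+1) (h (x i) (theta i) - w i).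
have s_le0 : nonpos_orthant s.
  move=> i; rewrite mxE summxE mulr_ge0_le0 ?invr_ge0 ?ler0n //.
  apply: sumr_le0 => j _; rewrite mxE [X in _ + X]mxE subr_le0; exact: slack_ge.
have hbar : h (xbar k) theta_star - s
    = k.+1%:R^-1 *: (\sum_(i < k.+1) (h (x i) theta_star - h (x i) (theta i))
                    + rho^-1 *: lambda k.+1).
  rewrite h_affine // affine_mean -scalerBr -sumrB -sumw -big_split /=.
  congr (_ *: _); apply: eq_bigr => i _.
  by rewrite -h_affine // opprB addrA addrAC.
have Lsum : \sum_(i < k.+1) enorm (h (x i) theta_star - h (x i) (theta i))
    <= L_h * E.
  have Le0 : 0 <= L_h * e0.
    apply: le_trans (h_lipschitz _ _ _ (x_in 0%N) (theta_in 0%N) ts_in).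
    exact: enorm_ge0.
  have Li i : enorm (h (x i) theta_star - h (x i) (theta i))
      <= L_h * (q_ell ^+ i * e0).
    rewrite -enormN opprB.
    apply: le_trans (h_lipschitz _ _ _ (x_in i) (theta_in i) ts_in) _.
    (* A negative [L_h] forces [e0 = 0], and then every [theta i] equals [theta_star]. *)
    have [L0|L0] := leP 0 L_h; first by rewrite ler_wpM2l.
    have e00 : e0 = 0 by apply/eqP; rewrite eq_le e0_ge0 andbT; nra.
    have := theta_cvg i; rewrite -/e0 e00 mulr0 => ei.
    have -> : enorm (theta i - theta_star) = 0.
      by apply/eqP; rewrite eq_le ei enorm_ge0.
    by rewrite !mulr0.
  apply: (@le_trans _ _ (\sum_(i < k.+1) L_h * (q_ell ^+ i * e0))).
    by apply: ler_sum => i _; exact: Li.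
  under eq_bigr do rewrite mulrCA.
  by rewrite -mulr_suml [leLHS]mulrC /E mulrA ler_wpM2l // sum_geometric_le.
apply: le_trans (dist_le _ s_le0) _; rewrite hbar enormZ ?invr_ge0 ?ler0n //.
have k0 : 0 < k.+1%:R :> R by rewrite ltr0n.
have C2E : C_2 = L_h * E + T / rho.
  have -> : C_2 = Num.sqrt (2 / rho) * S + (L_h + M_h) * e0 / (1 - q_ell) by [].
  have -> : Num.sqrt (2 / rho) = Num.sqrt (2 * rho) / rho.
    have -> : 2 / rho = 2 * rho / rho ^+ 2 by field.
    rewrite sqrtrM ?mulr_ge0 ?(ltW rho_gt0) // sqrtrV ?sqr_ge0 //.
    by rewrite sqrtr_sqr ger0_norm ?(ltW rho_gt0).
  by rewrite /T /E; field; rewrite rhoN gt_eqF.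
have C1E : C_1 = Num.sqrt (2 * (1 / (2 * rho) * enorm lambda_star ^+ 2
      + (T + enorm lambda_star) * (T / rho)) / rho
      + ((T + enorm lambda_star) / rho) ^+ 2).
  have TE : T / rho = Num.sqrt (2 / rho) * S + M_h * e0 / (1 - q_ell).
    apply: (@addrI _ (L_h * E)); rewrite -C2E /C_2 /E; ring.
  by rewrite TE.
rewrite C1E; move: rate; set C := Num.sqrt _ => rate.
(* Factoring out [k.+1%:R^-1] reduces the claim to [rate] plus the drift bound [Lsum]. *)
have -> : C / Num.sqrt k.+1%:R = k.+1%:R^-1 * (C * Num.sqrt k.+1%:R).
  have rN : Num.sqrt k.+1%:R != 0 :> R by rewrite gt_eqF // sqrtr_gt0.
  rewrite -[X in X^-1 * _]sqr_sqrtr ?ler0n //; move: (Num.sqrt _) rN => r rN.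
  by field.
rewrite C2E [X in _ <= _ + X]mulrC -mulrDr ler_wpM2l ?invr_ge0 ?ler0n //.
apply: le_trans (enormD _ _) _; rewrite enormZ ?invr_ge0 ?(ltW rho_gt0) //.
rewrite [rho^-1 * _]mulrC.
have := enorm_sum k.+1 (fun i => h (x i) theta_star - h (x i) (theta i)).
by move=> /= hs; lra.
Qed.
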